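(* Let $\Omega\subseteq\mathbb{R}^n$ be open and connected and let $u\in C^2(\Omega)$ be real-valued. If there is a function $f>0$ (defined on $u(\Omega)$) such that $|\nabla u(x)| = f(u(x))$ for all $x\in\Omega$, then $\mathcal{I}:=u(\Omega)$ is an open interval and $f\in C^1(\mathcal{I})$. *)

(* Defs.v *)
From HB Require Import structures.
From mathcomp Require Import all_boot all_order all_algebra.
From mathcomp Require Import all_classical all_reals all_analysis.

Set Implicit Arguments.
Unset Strict Implicit.
Unset Printing Implicit Defensive.

Import Order.TTheory GRing.Theory Num.Theory.
Import numFieldNormedType.Exports.

Local Open Scope classical_set_scope.
Local Open Scope ring_scope.

(* The library norm `|v| on 'rV[R]_n is the sup norm; it induces the usual
   topology, but |grad u| requires the Euclidean norm. *)
Definition enorm (R : realType) (n : nat) (v : 'rV[R]_n) : R :=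
  Num.sqrt (\sum_(i < n) v 0 i ^+ 2).

Definition gradient (R : realType) (n : nat) (u : 'rV[R]_n -> R)
    (x : 'rV[R]_n) : 'rV[R]_n :=
  \row_(i < n) 'D_(delta_mx 0 i) u x.

(* C^k(Omega) for Omega open: all iterated partial derivatives of order at
   most k exist and are continuous on Omega. Only the values of u on Omega
   matter, so u is given as a total function. *)
Fixpoint class_C (R : realType) (n : nat) (k : nat) (Omega : set 'rV[R]_n)
    (u : 'rV[R]_n -> R) : Prop :=
  (forall x, Omega x -> {for x, continuous u}) /\
  (if k is k'.+1 then
     forall i : 'I_n,
       (forall x, Omega x -> derivable u x (delta_mx 0 i)) /\
       class_C k' Omega ('D_(delta_mx 0 i) u)
   else True).

(* Meant for open I, where pointwise limits only see values of f on I. *)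
Definition class_C1_real (R : realType) (I : set R) (f : R -> R) : Prop :=
  (forall y, I y -> derivable f y 1) /\
  (forall y, I y -> {for y, continuous (derive1 f)}).

(* The endpoints may be infinite; a >= b gives the empty interval, which is
   u(Omega) exactly when Omega is empty. *)
Definition open_interval (R : realType) (I : set R) : Prop :=
  exists a b : \bar R, I = [set y | (a < y%:E < b)%E].

(* Main.v *)
Require Import Defs.
From HB Require Import structures.
From mathcomp Require Import all_boot all_order all_algebra.
From mathcomp Require Import all_classical all_reals all_analysis.

Import Order.TTheory GRing.Theory Num.Theory.
Import numFieldNormedType.Exports.

Local Open Scope classical_set_scope.
Local Open Scope ring_scope.

(* At a point x of Omega some partial derivative D_i u is nonzero, since
   |grad u| = f(u) > 0. Restricted to the line x + t e_i, u is therefore a local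
   C^1 diffeomorphism of R with inverse k, so u(Omega) is a neighbourhood of u x
   and f y = |grad u (x + k(y) e_i)| for y near u x. The right-hand side is
   differentiable, and the chain rule gives f'(u z) as an expression in the
   derivatives of u that is continuous in z wherever D_i u(z) <> 0. *)

(** The endpoints are the infimum and supremum of [I] in the extended reals. Openness makes both
    inequalities strict, as [y - e / 2] and [y + e / 2] stay in [I]. Conversely, a [y] strictly
    between them has points of [I] on either side. For empty [I] they are +oo and -oo, as
    required. *)
Lemma open_is_interval_open_interval (R : realType) (I : set R) :
  open I -> is_interval I -> open_interval I.
Proof.
move=> oI iI; exists (ereal_inf (EFin @` I)), (ereal_sup (EFin @` I)).
apply/seteqP; split => [y Iy|y /= /andP[/ereal_inf_lt[_ [a Ia <-] ay]]].
  have /nbhs_ballP[e /= e0 eI] : nbhs y I by exact: open_nbhs_nbhs.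
  have e20 : 0 < e / 2 by rewrite divr_gt0.
  have e2e : e / 2 < e by rewrite ltr_pdivrMr// ltr_pMr// ltr1n.
  apply/andP; split.
    apply: (@le_lt_trans _ _ (y - e / 2)%:E); last by rewrite lte_fin gtrBl.
    apply: ereal_inf_lbound; exists (y - e / 2) => //; apply: eI.
    by rewrite /ball/= subKr gtr0_norm.
  apply: (@lt_le_trans _ _ (y + e / 2)%:E); first by rewrite lte_fin ltrDl.
  apply: ereal_sup_ubound; exists (y + e / 2) => //; apply: eI.
  by rewrite /ball/= opprD addNKr normrN gtr0_norm.
move=> /ereal_sup_gt[_ [b Ib <-] yb].
by apply: (iI a b) => //; rewrite -!lee_fin (ltW ay) (ltW yb).
Qed.

Lemma is_derive_line (R : realType) (V W : normedModType R) (u : V -> W)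
    (x v : V) (t : R) : derivable u (x + t *: v) v ->
  is_derive t 1 (fun s => u (x + s *: v)) ('D_v u (x + t *: v)).
Proof.
(* The two difference quotients are the same function of [h], so existence and value of the limit
   transfer together. *)
have E : (fun h : R => h^-1 *: (u (x + (h *: (1 : R) + t) *: v) - u (x + t *: v))) =
         (fun h : R => h^-1 *: (u (h *: v + (x + t *: v)) - u (x + t *: v))).
  apply/funext => h; have -> : h *: (1 : R) = h by exact: mulr1.
  by rewrite scalerDl addrCA.
by move=> du; apply: DeriveDef; rewrite /derivable/derive /shift/= E.
Qed.

Lemma continuous_line (R : realType) (V : normedModType R) (x v : V) :
  continuous (fun t : R => x + t *: v).
Proof.
by move=> t; apply: cvgD; [exact: cvg_cst|apply: cvgZr_tmp; exact: cvg_id].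
Qed.

(** Rolle's argument: two distinct points of the ball with equal images would, by the mean value
    theorem, enclose a zero of [g']. *)
Lemma near_injective_derive (R : realType) (g g' : R -> R) (t0 : R) :
  (\forall t \near t0, is_derive (t : R) 1 g (g' t)) ->
  (\forall t \near t0, g' t != 0) ->
  exists2 e, 0 < e & {in (ball t0 e : set R) &, injective g}.
Proof.
move=> dg g'0.
have /nbhs_ballP[e /= e0 eB] : \forall t \near t0,
  is_derive (t : R) 1 g (g' t) /\ g' t != 0 by near=> t; split; near: t.
exists e => // s t; rewrite !inE => Bs Bt.
wlog st : s t Bs Bt / s <= t.
  by move=> W; have [/W|/ltW/W W' /esym/W' ->] := leP s t; first exact.
move: st; rewrite le_eqVlt => /predU1P[//|st] gst.
have inB c : s <= c <= t -> ball t0 e c.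
  move: Bs Bt; rewrite /ball/= !ltr_distlC => /andP[s1 s2] /andP[t1 t2].
  by move=> /andP[sc ct]; rewrite (lt_le_trans s1)// (le_lt_trans ct).
have [||c cst] := @MVT R g g' s t st.
- move=> c; rewrite in_itv/= => /andP[/ltW sc /ltW ct].
  by have /eB[] : ball t0 e c by apply: inB; rewrite sc.
- apply: continuous_in_subspaceT => c; rewrite inE/= in_itv/= => /inB /eB[[dc _] _].
  exact/differentiable_continuous/derivable1_diffP.
rewrite -gst subrr => /esym/eqP; rewrite mulf_eq0 subr_eq0 (gt_eqF st) orbF.
move: cst; rewrite in_itv/= => /andP[/ltW sc /ltW ct].
have /eB[_ /negPf ->] : ball t0 e c by apply: inB; rewrite sc.
by [].
Unshelve. all: by end_near. Qed.

(** Injectivity on a ball makes the partial inverse ['pinv_] a left inverse near [t0], with dummy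
    value [t0] off the image of the ball. Continuity of [g] near [t0] then makes it a right inverse
    near [g t0] and continuous there. *)
Lemma local_inverse_derive (R : realType) (g g' : R -> R) (t0 : R) :
  (\forall t \near t0, is_derive (t : R) 1 g (g' t)) ->
  (\forall t \near t0, g' t != 0) ->
  exists k : R -> R, [/\ k (g t0) = t0, \forall y \near g t0, g (k y) = y,
    {for g t0, continuous k} & is_derive (g t0) 1 k (g' t0)^-1].
Proof.
move=> dg g'0; have [e e0 ginj] := near_injective_derive _ _ _ _ dg g'0.
have kg : {near t0, cancel g ('pinv_(fun=> t0) (ball t0 e) g)}.
  near=> t; apply: pinvKV => //; rewrite inE; near: t; exact: nbhsx_ballx.
have cg : \forall t \near t0, {for t, continuous g}.
  near=> t; have [dt _] : is_derive (t : R) 1 g (g' t) by near: t.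
  exact/differentiable_continuous/derivable1_diffP.
exists ('pinv_(fun=> t0) (ball t0 e) g); split.
- exact: nbhs_singleton kg.
- exact: near_continuous_can_sym.
- exact: nbhs_singleton (near_can_continuous kg cg).
- apply: is_derive_inverse => //; first exact: nbhs_singleton dg.
  exact: nbhs_singleton g'0.
Unshelve. all: by end_near. Qed.

Lemma continuous_comp_line (R : realType) (V : normedModType R) (w : V -> R)
    (x v : V) (t : R) : {for x + t *: v, continuous w} ->
  {for t, continuous (fun s : R => w (x + s *: v))}.
Proof.
exact: (@continuous_comp _ _ _ (fun s : R => x + s *: v) w t
  (@continuous_line R V x v t)).
Qed.

Lemma class_CS (R : realType) (n k : nat) (Omega : set 'rV[R]_n)
    (u : 'rV[R]_n -> R) : class_C k.+1 Omega u -> class_C k Omega u.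
Proof.
elim: k u => [|k IHk] u [cu Du]; split => // i.
by have [du /IHk] := Du i.
Qed.

(** The curve [x + k y *: e_i] is a local section of [u] through [x]. It comes from inverting [u]
    along the line: the [i]-th partial derivative is continuous, hence nonzero near [x]. *)
Lemma class_C1_line_inverse (R : realType) (n : nat) (Omega : set 'rV[R]_n)
    (u : 'rV[R]_n -> R) (x : 'rV[R]_n) (i : 'I_n) :
  open Omega -> class_C 1 Omega u -> Omega x ->
  'D_(delta_mx 0 i) u x != 0 ->
  exists k : R -> R, [/\ k (u x) = 0, {for u x, continuous k},
    is_derive (u x) 1 k ('D_(delta_mx 0 i) u x)^-1 &
    \forall y \near u x, Omega (x + k y *: delta_mx 0 i) /\
                         u (x + k y *: delta_mx 0 i) = y].
Proof.
move=> oO [cu /(_ i)[du [cdu _]]] Ox nz; set e : 'rV[R]_n := delta_mx 0 i.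
pose g (t : R) := u (x + t *: e); pose g' (t : R) : R := 'D_e u (x + t *: e).
have x0 : x + 0 *: e = x by rewrite scale0r addr0.
have cline := @continuous_line R _ x e.
have Oline : \forall t \near (0 : R), Omega (x + t *: e).
  by apply: (cline 0); rewrite x0; exact: open_nbhs_nbhs.
have [||k []] := @local_inverse_derive R g g' 0.
- near=> t; apply: is_derive_line; apply: du; near: t; exact: Oline.
- have : {for (0 : R), continuous g'}.
    by apply: (@continuous_comp_line R _ ('D_e u)); rewrite x0; exact: cdu.
  by move/cvgr_neq0; apply; rewrite /g' x0.
rewrite /g /g' x0 => k0 gk ck dk; exists k; split => //.
(* As [k] is continuous at [u x] with value 0, it sends nearby [y] to parameters at which the line
   is still in [Omega]. *)
have Ok : \forall y \near u x, Omega (x + k y *: e).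
  have := ck [set t | Omega (x + t *: e)]; rewrite k0; exact.
by near=> y; split; near: y.
Unshelve. all: by end_near. Qed.

Lemma is_derive_enorm_line (R : realType) (n : nat)
    (w w' : 'I_n -> R -> R) (t : R) :
  (forall j, is_derive t 1 (w j) (w' j t)) ->
  0 < enorm (\row_j w j t) ->
  is_derive t 1 (fun s => enorm (\row_j w j s))
    ((\sum_j w j t * w' j t) / enorm (\row_j w j t)).
Proof.
pose q (s : R) := \sum_j w j s ^+ 2.
have qE s : enorm (\row_j w j s) = Num.sqrt (q s).
  by rewrite /enorm; congr Num.sqrt; apply: eq_bigr => j _; rewrite mxE.
move=> dw; rewrite (_ : (fun s => _) = Num.sqrt \o q); last exact/funext.
rewrite qE sqrtr_gt0 => q0.
have dq : is_derive t 1 q (\sum_j 2 * w j t * w' j t).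
  rewrite (_ : q = \sum_j (w j ^+ 2)); last first.
    by apply/funext => s; rewrite fct_sumE.
  by apply: is_derive_sum => j; apply: is_derive_eq; rewrite expr1.
have ds := @is_derive1_sqrt R (q t) q0.
apply: (is_derive_eq (is_derive1_comp ds dq)).
(* The factor 2 from the squares cancels the one in the derivative 1 / (2 sqrt q) of the square
   root. *)
under eq_bigr do rewrite -mulrA.
rewrite -mulr_sumr invfM mulrACA mulVf ?mul1r 1?mulrC// pnatr_eq0.
Qed.

(** Along the section, f(y) = |grad u (x + k(y) e_i)| for [y] near [u x]. The chain rule at [u x]
    multiplies the derivative of |grad u| in direction e_i by k'(u x) = 1 / D_i u(x). *)
Lemma is_derive_eikonal (R : realType) (n : nat) (Omega : set 'rV[R]_n)
    (u : 'rV[R]_n -> R) (f : R -> R) (x : 'rV[R]_n) (i : 'I_n) :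
  open Omega -> class_C 2 Omega u ->
  (forall z, Omega z -> enorm (gradient u z) = f (u z)) ->
  Omega x -> 0 < f (u x) -> 'D_(delta_mx 0 i) u x != 0 ->
  is_derive (u x) 1 f
    ((\sum_j 'D_(delta_mx 0 j) u x * 'D_(delta_mx 0 i) ('D_(delta_mx 0 j) u) x)
      / enorm (gradient u x) / 'D_(delta_mx 0 i) u x).
Proof.
move=> oO u2 gu Ox fx nz; set e : 'rV[R]_n := delta_mx 0 i.
have [k [k0 ck dk nk]] : exists k : R -> R, _ :=
  @class_C1_line_inverse R n Omega u x i oO (@class_CS _ _ _ _ _ u2) Ox nz.
have x0 : x + 0 *: e = x by rewrite scale0r addr0.
pose h (t : R) := enorm (gradient u (x + t *: e)).
apply: (@near_eq_is_derive _ _ _ (h \o k)).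
  by near=> y; have [Oy uy] : Omega (x + k y *: e) /\ u (x + k y *: e) = y;
    [near: y|rewrite /h/= gu// uy].
apply: is_derive1_comp; rewrite k0.
have := @is_derive_enorm_line R n
  (fun j t => 'D_(delta_mx 0 j) u (x + t *: e))
  (fun j t => 'D_e ('D_(delta_mx 0 j) u) (x + t *: e)) 0.
rewrite x0; apply; last by rewrite -/(gradient u x) gu.
move=> j; have := @is_derive_line R _ _ ('D_(delta_mx 0 j) u) x e 0.
rewrite x0; apply.
by have [_ /(_ j)[_ [_ /(_ i)[+ _]]]] := u2; exact.
Unshelve. all: by end_near. Qed.

Lemma continuous_sum_ord (R : realType) (T : topologicalType) (n : nat)
    (h : 'I_n -> T -> R) (x : T) : (forall j, {for x, continuous (h j)}) ->
  {for x, continuous (fun z => \sum_j h j z)}.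
Proof.
move=> ch; rewrite (_ : (fun z => _) = \sum_j h j); last first.
  by apply/funext => z; rewrite fct_sumE.
apply: (big_ind (fun g : T -> R => {for x, continuous g})) => //.
- exact: cvg_cst.
- by move=> g1 g2 c1 c2; exact: continuousD.
Qed.

Lemma gradient_neq0_partial (R : realType) (n : nat) (u : 'rV[R]_n -> R)
    (x : 'rV[R]_n) : 0 < enorm (gradient u x) ->
  exists i, 'D_(delta_mx 0 i) u x != 0.
Proof.
move=> gt0; apply: contrapT => /forallNP D0; move: gt0.
rewrite /enorm big1 ?sqrtr0 ?ltxx// => i _; rewrite mxE.
by have /negP/negPn/eqP -> := D0 i; rewrite expr0n.
Qed.

Theorem proposition1p2 (R : realType) (n : nat) (Omega : set 'rV[R]_n)
    (u : 'rV[R]_n -> R) (f : R -> R)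
    (Omega_open : open Omega) (Omega_connected : connected Omega)
    (u_C2 : class_C 2 Omega u)
    (f_gt0 : forall y, (u @` Omega) y -> 0 < f y)
    (grad_u : forall x, Omega x -> enorm (gradient u x) = f (u x)) :
  open_interval (u @` Omega) /\ class_C1_real (u @` Omega) f.
Proof.
have [cu Du] := u_C2.
have fu_gt0 x : Omega x -> 0 < f (u x) by move=> Ox; apply: f_gt0; exists x.
have partial x : Omega x -> exists i, 'D_(delta_mx 0 i) u x != 0.
  by move=> Ox; apply: gradient_neq0_partial; rewrite grad_u// fu_gt0.
have df x (i : 'I_n) (Ox : Omega x) (nz : 'D_(delta_mx 0 i) u x != 0) :=
  @is_derive_eikonal R n Omega u f x i Omega_open u_C2 grad_u Ox
    (fu_gt0 x Ox) nz.
have inv x (i : 'I_n) (Ox : Omega x) (nz : 'D_(delta_mx 0 i) u x != 0) :=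
  @class_C1_line_inverse R n Omega u x i Omega_open
    (@class_CS _ _ _ _ _ u_C2) Ox nz.
split.
  apply: open_is_interval_open_interval.
    (* Every [y] near [u x] is attained by [u] on the section through [x]. *)
    rewrite openE => _ [x Ox <-]; have [i nz] := partial x Ox.
    have [k [_ _ _ nk]] := inv x i Ox nz.
    by apply: filterS nk => y [Oy uy]; exists (x + k y *: delta_mx 0 i).
  apply/connected_intervalP; apply: connected_continuous_connected => //.
  by apply: continuous_in_subspaceT => x; rewrite inE => /cu.
have diff_f x : Omega x -> derivable f (u x) 1.
  by move=> Ox; have [i nz] := partial x Ox; have [] := df x i Ox nz.
split => _ [x Ox <-]; first exact: diff_f.
have [i nz] := partial x Ox; set e : 'rV[R]_n := delta_mx 0 i.
have [k [k0 ck dk nk]] := inv x i Ox nz.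
have x0 : x + 0 *: e = x by rewrite scale0r addr0.
have cdu j z : Omega z -> {for z, continuous ('D_(delta_mx 0 j) u)}.
  by have [_ [+ _]] := Du j; exact.
have cddu j z : Omega z ->
    {for z, continuous ('D_e ('D_(delta_mx 0 j) u))}.
  by have [_ [_ /(_ i)[_ [+ _]]]] := Du j; exact.
(* The formula for f'(u z), with f(u z) written for |grad u(z)|: its continuity at [x] then follows
   from that of [f] at [u x], already known by differentiability. *)
pose slope (z : 'rV[R]_n) : R :=
  (\sum_j 'D_(delta_mx 0 j) u z * 'D_e ('D_(delta_mx 0 j) u) z) / f (u z)
    / 'D_e u z.
have cslope : {for x, continuous slope}.
  apply: continuousM; last by apply: continuousV => //; exact: cdu.
  apply: continuousM.
    apply: continuous_sum_ord => j.
    by apply: continuousM; [exact: cdu|exact: cddu].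
  apply: continuousV; first by rewrite gt_eqF// fu_gt0.
  apply: continuous_comp; first exact: cu.
  exact/differentiable_continuous/derivable1_diffP/diff_f.
have cline : {for u x, continuous (fun y => slope (x + k y *: e))}.
  apply: (@continuous_comp _ _ _ k (fun t : R => slope (x + t *: e))) => //.
  by rewrite k0; apply: (@continuous_comp_line R _ slope); rewrite x0.
(* The derivative formula is applied not at [x] but at the point of the section over [y], with the
   same [i]: by continuity D_i u is still nonzero there. *)
have f'E : \forall y \near u x, derive1 f y = slope (x + k y *: e).
  have nzk : \forall y \near u x, 'D_e u (x + k y *: e) != 0.
    have : {for u x, continuous (fun y => 'D_e u (x + k y *: e) : R)}.
      apply: (@continuous_comp _ _ _ k (fun t : R => 'D_e u (x + t *: e) : R)) => //.
      rewrite k0; apply: (@continuous_comp_line R _ ('D_e u)).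
      by rewrite x0; exact: cdu.
    by move/cvgr_neq0; apply; rewrite k0 x0.
  near=> y; have [Oy uy] : Omega (x + k y *: e) /\ u (x + k y *: e) = y by near: y.
  have nzy : 'D_e u (x + k y *: e) != 0 by near: y.
  have := df _ i Oy nzy; rewrite grad_u// uy => dfy.
  by rewrite derive1E (@derive_val _ _ _ _ _ _ _ dfy) /slope uy.
(* [derive1 f] coincides near [u x] with [slope] along the section, hence inherits its continuity at
   [u x]. *)
apply: cvg_trans; first apply: near_eq_cvg.
  by apply: filterS f'E => y ->.
by rewrite (nbhs_singleton f'E); exact: cline.
Unshelve. all: by end_near. Qed.
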